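(* (Equivalence of the linear bootstrap and the sandwich estimator.) Let $w\sim\mathrm{Multinomial}(N,N^{-1}1_N)$ be bootstrap weights ($N$ trials, $N$ outcomes, all probabilities equal to $N^{-1}$), and let $\mathrm{Cov}_b(\cdot)$ denote the covariance taken with respect to the randomness in $w$ alone. Let $\widehat{\mathrm{Cov}}(g_n(\hat\theta))$ denote the sample covariance of the $N$ observations $g_1(\hat\theta),\dots,g_N(\hat\theta)$. Then $$\mathrm{Cov}_b\big(\hat\theta^{IJ}_1(w)\big)=\hat H^{-1}\,\widehat{\mathrm{Cov}}(g_n(\hat\theta))\,\hat H^{-1}.$$
   Context: $g_0,g_1,\dots,g_N$ are continuously differentiable functions of $\theta\in\mathbb{R}^D$ with values in $\mathbb{R}^D$, and $G(\theta,w):=\frac1N\big(g_0(\theta)+\sum_{n=1}^Nw_ng_n(\theta)\big)$ for $w\in\mathbb{R}^N$. $\hat\theta(w)$ denotes a solution $\theta$ of $G(\theta,w)=0$, $1_N$ is the all-ones vector of length $N$, and $\hat\theta:=\hat\theta(1_N)$. $\hat H:=\frac{\partial G(\theta,1_N)}{\partial\theta}\big|_{\theta=\hat\theta}$ is a $D\times D$ matrix, assumed invertible. The first-order infinitesimal jackknife $\hat\theta^{IJ}_1(w)$ is the first-order Taylor expansion of $\hat\theta(w)$ in $w$ about $1_N$, namely $$\hat\theta^{IJ}_1(w)=\hat\theta-\hat H^{-1}\,\frac1N\sum_{n=1}^N(w_n-1)\,g_n(\hat\theta).$$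
   Formalization: The printed identity is false as it stands: the formal one has an extra factor 1/N on the right (sample covariance with divisor N) and transposes the second inverse of H-hat, which is not assumed symmetric; e.g. D=1, N=2, g_1=t-1, g_2=t+1 gives 1/2, not 1 or 2. *)

(* Defs.v *)
(* MathComp-Analysis; vectors are columns. *)
From HB Require Import structures.
From mathcomp Require Import all_boot all_order all_algebra.
From mathcomp Require Import all_classical all_reals all_analysis.
Set Implicit Arguments.
Unset Strict Implicit.
Unset Printing Implicit Defensive.
Import Order.TTheory GRing.Theory Num.Theory.
Import numFieldNormedType.Exports.
Local Open Scope classical_set_scope.
Local Open Scope ring_scope.

Section estimating_equation.
Context {R : realType}.

(* The library's [jacobian] acts on row vectors and is the transpose of the
   usual matrix; here entry (i, j) is the derivative of f_i along the j-th
   coordinate. *)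
Definition jac m n (f : 'cV[R]_n -> 'cV[R]_m) (x : 'cV[R]_n) : 'M[R]_(m, n) :=
  \matrix_(i, j) 'D_(delta_mx j 0) (fun y => f y i 0) x.

Definition contdiff m n (f : 'cV[R]_n -> 'cV[R]_m) : Prop :=
  (forall x, differentiable f x) /\ continuous (jac f).

Context {N D : nat}.
Variables (g0 : 'cV[R]_D -> 'cV[R]_D) (g : 'I_N -> 'cV[R]_D -> 'cV[R]_D).

Definition ones : 'cV[R]_N := const_mx 1.

Definition G (theta : 'cV[R]_D) (w : 'cV[R]_N) : 'cV[R]_D :=
  N%:R^-1 *: (g0 theta + \sum_(n < N) w n 0 *: g n theta).

Definition Hhat (thetahat : 'cV[R]_D) : 'M[R]_D :=
  jac (fun theta => G theta ones) thetahat.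

Definition IJ1 (thetahat : 'cV[R]_D) (w : 'cV[R]_N) : 'cV[R]_D :=
  thetahat - invmx (Hhat thetahat) *m
    (N%:R^-1 *: \sum_(n < N) (w n 0 - 1) *: g n thetahat).

End estimating_equation.
Arguments ones {R} N.

Section covariances.
Context {R : realType}.

(* Normalised by N rather than N - 1, matching the multinomial covariance
   Cov(w) = 1%:M - N^-1 *: ones *m ones^T. *)
Definition sample_cov N D (x : 'I_N -> 'cV[R]_D) : 'M[R]_D :=
  let xbar := N%:R^-1 *: \sum_(n < N) x n in
  N%:R^-1 *: \sum_(n < N) (x n - xbar) *m (x n - xbar)^T.

Context {d : measure_display} {T : measurableType d} (P : probability T R).

Definition covmx D (X : T -> 'cV[R]_D) : 'M[\bar R]_D :=
  \matrix_(i, j) covariance P (fun t => X t i 0) (fun t => X t j 0).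

Definition multinomial_pmf K (m : nat) (p : 'cV[R]_K) (k : 'I_K -> nat) : R :=
  if (\sum_(i < K) k i)%N == m
  then m`!%:R / (\prod_(i < K) (k i)`!)%:R * \prod_(i < K) p i 0 ^+ k i
  else 0.

Definition multinomial K (m : nat) (p : 'cV[R]_K) (W : 'I_K -> {RV P >-> nat}) :
    Prop :=
  forall k : 'I_K -> nat,
    P [set t | forall i, W i t = k i] = (multinomial_pmf m p k)%:E.

Definition weights K (W : 'I_K -> {RV P >-> nat}) (t : T) : 'cV[R]_K :=
  \col_i (W i t)%:R.

End covariances.

Section taylor.
Context {R : realType} {N D : nat}.
Variables (g0 : 'cV[R]_D -> 'cV[R]_D) (g : 'I_N -> 'cV[R]_D -> 'cV[R]_D).

Lemma derive_comp_jac m n p (f : 'cV[R]_n -> 'cV[R]_m)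
    (h : 'cV[R]_p -> 'cV[R]_n) x v i :
  differentiable h x -> differentiable f (h x) ->
  is_derive x v (fun y => f (h y) i 0) ((jac f (h x) *m 'd h x v) i 0).
Proof.
move=> dh df.
pose c (y : 'cV[R]_m) : R := y i 0.
have dc y : differentiable c y by exact: differentiable_coord.
have dcf : differentiable (c \o f) (h x) by exact: differentiable_comp.
have dcfh : differentiable ((c \o f) \o h) x by exact: differentiable_comp.
apply: DeriveDef; first exact: (diff_derivable dcfh).
rewrite -[LHS]/('D_v ((c \o f) \o h) x) (deriveE _ dcfh) diff_comp //= mxE.
set u := 'd h x v.
rewrite [in LHS](matrix_sum_delta u) linear_sum /=; apply: eq_bigr => j _.
by rewrite linear_sum big_ord1 linearZ /= mxE -deriveE // mulrC.
Qed.

Lemma is_derive_coord m n (a v : 'M[R]_(m, n)) i j :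
  is_derive a v (fun y : 'M[R]_(m, n) => y i j : R) (v i j).
Proof.
have dc := differentiable_coord a i j.
apply: DeriveDef; first exact: (diff_derivable dc).
have @f : {linear 'M[R]_(m, n) -> R}.
  by exists (fun y : 'M[R]_(_, _) => y i j); do 2![eexists]; do ?[constructor];
     rewrite ?mxE// => ? *; rewrite ?mxE//; move=> ?; rewrite !mxE.
rewrite (deriveE _ dc) (_ : (fun _ => _) = f) // diff_lin //.
exact: coord_continuous.
Qed.

(* The closed formula [IJ1] is the first-order Taylor expansion at 1_N of any
   differentiable branch of solutions of the estimating equation. *)
Lemma IJ1_taylor (thetahat : 'cV[R]_N -> 'cV[R]_D) (w : 'cV[R]_N) :
  contdiff g0 -> (forall n, contdiff (g n)) ->
  (\forall w' \near ones N, G g0 g (thetahat w') w' = 0) ->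
  differentiable thetahat (ones N) ->
  Hhat g0 g (thetahat (ones N)) \in unitmx ->
  IJ1 g0 g (thetahat (ones N)) w =
    thetahat (ones N) + 'd thetahat (ones N) (w - ones N).
Proof.
move=> [dg0 _] dg solb dth Hu.
set w1 := ones N; set L := thetahat w1; set v := w - w1.
set u := 'd thetahat w1 v.
have dgn n x : differentiable (g n) x by have [+ _] := dg n; apply.
have jacG : Hhat g0 g L = N%:R^-1 *: (jac g0 L + \sum_(n < N) jac (g n) L).
  apply/matrixP => i j; pose e : 'cV[R]_D := delta_mx j 0.
  have dcoord (f : 'cV[R]_D -> 'cV[R]_D) : differentiable f L ->
      is_derive L e (fun x => f x i 0) (jac f L i j).
    move=> df; rewrite mxE; apply: DeriveDef => //.
    have dc : differentiable (fun y : 'cV[R]_D => y i 0 : R) (f L).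
      exact: differentiable_coord.
    exact: (diff_derivable (differentiable_comp df dc)).
  have dG : is_derive L e
      (N%:R^-1 \*: ((fun x => g0 x i 0) + \sum_(n < N) (fun x => g n x i 0)))
      (N%:R^-1 *: (jac g0 L i j + \sum_(n < N) jac (g n) L i j)).
    apply: is_deriveZ; apply: is_deriveD; first exact: dcoord.
    by apply: is_derive_sum => n; exact: dcoord.
  rewrite [RHS](_ : _ = N%:R^-1 *: (jac g0 L i j + \sum_(n < N) jac (g n) L i j)).
    rewrite -[RHS](@derive_val _ _ _ _ _ _ _ dG) mxE.
    congr ('D_e _ L); apply/funext => x.
    rewrite /G !mxE /= !fctE /= summxE fct_sumE; congr (_ * (_ + _)).
    by apply: eq_bigr => n _; rewrite !mxE mul1r.
  by rewrite !mxE summxE.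
have eq0 : N%:R^-1 *: (\sum_(n < N) v n 0 *: g n L) + Hhat g0 g L *m u = 0.
  apply/matrixP => i j; rewrite ord1 {j}.
  have dw n : is_derive w1 v (fun w' : 'cV[R]_N => w' n 0 : R) (v n 0).
    exact: is_derive_coord.
  pose F := (N%:R^-1 : R) \*: ((fun w' => g0 (thetahat w') i 0) +
    \sum_(n < N) ((fun w' : 'cV[R]_N => w' n 0 : R) *
                  (fun w' => g n (thetahat w') i 0))).
  have dF : is_derive w1 v F (N%:R^-1 *: ((jac g0 L *m u) i 0 +
      \sum_(n < N) (w1 n 0 *: (jac (g n) L *m u) i 0 + g n L i 0 *: v n 0))).
    apply: is_deriveZ; apply: is_deriveD; first exact: derive_comp_jac.
    apply: is_derive_sum => n; apply: is_deriveM.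
    exact: derive_comp_jac.
  have F0 : 'D_v F w1 = 0.
    rewrite -(derive_cst (0 : R) w1 v); apply: near_eq_derive.
    move: solb; apply: filterS => w' /(congr1 (fun M : 'cV[R]_D => M i 0)).
    rewrite /G !mxE summxE => FE; rewrite /F !fctE /= fct_sumE -[RHS]FE.
    by congr (_ * (_ + _)); apply: eq_bigr => n _; rewrite !mxE.
  rewrite [RHS]mxE -F0 derive_val jacG -scalemxAl mulmxDl mulmx_suml !mxE !summxE.
  rewrite -mulrDr addrCA -big_split /=; congr (_ * (_ + _)).
  apply: eq_bigr => n _; rewrite [w1 n 0]mxE scale1r [in LHS]mxE addrC.
  by rewrite [X in _ + X]mulrC.
rewrite /IJ1 -/w1 -/L; congr (_ + _).
move/eqP: eq0; rewrite addr_eq0 => /eqP.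
rewrite [\sum_(n < N) (_ - 1) *: _](_ : _ = \sum_(n < N) v n 0 *: g n L); last first.
  by apply: eq_bigr => n _; rewrite !mxE.
by move=> ->; rewrite mulmxN opprK mulKmx.
Qed.

End taylor.

(* Main.v *)
Require Import Defs.
From mathcomp Require Import all_boot all_order all_algebra.
From mathcomp Require Import all_classical all_reals all_analysis.
From mathcomp Require Import measurable_realfun.
From mathcomp Require Import ring.
Import Order.TTheory GRing.Theory Num.Theory.
Import numFieldNormedType.Exports.
Local Open Scope classical_set_scope.
Local Open Scope ring_scope.

(** The linearised estimator is affine in the weights: its i-th coordinate is a
    constant plus [\sum_n a_n (w_n - 1)], where [a_n] is [- N^-1] times the i-th
    coordinate of [H^-1 g_n].  Its covariance matrix is thus determined by the
    covariances of the multinomial weights, [m (p_i delta_ij - p_i p_j)].  For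
    [m = N] and [p_i = N^-1] the bilinear form with this matrix,
    [\sum a_n b_n - N^-1 (\sum a_n) (\sum b_n)], is [N] times the sample
    covariance of [a] and [b] (normalised by [N]), and sample covariance
    turns multiplication by [H^-1] into conjugation.

    The multinomial moments come from a single identity, size biasing:
    [k_i] times the mass of [k] for [m+1] trials is [(m+1) p_i] times the mass of
    [k - e_i] for [m] trials ([multinomial_pmf_incr], [pmf_mean_sizebias]).
    Summed over [i] it gives total mass 1 by induction on [m], with no appeal to
    the multinomial theorem ([pmf_mean1]); applied once and twice it gives the
    first and second moments.

    The link with the measure [P] is [multinomial_expectation].  The
    distribution is prescribed by point masses, and the finitely many vectors
    bounded by [m] already carry mass 1, so an expectation of a function of
    the weights is a finite sum. *)

(** * Size biasing of the multinomial mass function *)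

Definition incr {K : nat} (i : 'I_K) (k : 'I_K -> nat) : 'I_K -> nat :=
  fun j => (k j + (j == i))%N.

Lemma sum_incr {K : nat} (i : 'I_K) (k : 'I_K -> nat) :
  (\sum_j incr i k j = (\sum_j k j).+1)%N.
Proof.
rewrite /incr big_split /= -addn1; congr addn.
by rewrite (bigD1 i) //= eqxx big1 // => j /negPf ->.
Qed.

(** Both sides count [m+1] labelled trials with one trial of outcome [i] marked:
    the factor [k_i + 1] cancels against the factorial of the i-th coordinate. *)
Lemma multinomial_pmf_incr {R : realType} {K : nat} (m : nat) (p : 'cV[R]_K)
    (i : 'I_K) (k : 'I_K -> nat) :
  multinomial_pmf m.+1 p (incr i k) * (k i).+1%:R =
  m.+1%:R * p i 0 * multinomial_pmf m p k.
Proof.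
rewrite /multinomial_pmf sum_incr eqSS; case: ifP => _; last by rewrite mul0r mulr0.
rewrite (bigD1 i) //= (bigD1 (F := fun j => (k j)`!) i) //=.
rewrite (bigD1 (F := fun j => p j 0 ^+ incr i k j) i) //=.
rewrite (bigD1 (F := fun j => p j 0 ^+ k j) i) //=.
rewrite {1 3}/incr eqxx addn1 factS exprS factS.
have -> : (\prod_(j < K | j != i) (incr i k j)`! = \prod_(j < K | j != i) (k j)`!)%N.
  by apply: eq_bigr => j /negPf ji; rewrite /incr ji addn0.
have -> : \prod_(j < K | j != i) p j 0 ^+ incr i k j =
    \prod_(j < K | j != i) p j 0 ^+ k j.
  by apply: eq_bigr => j /negPf ji; rewrite /incr ji addn0.
set A := (\prod_(j < K | _) _)%N; set B := \prod_(j < K | _) _.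
have A0 : A%:R != 0 :> R.
  by rewrite pnatr_eq0 -lt0n prodn_gt0 // => j; exact: fact_gt0.
have k0 : (k i)`!%:R != 0 :> R by rewrite pnatr_eq0 -lt0n fact_gt0.
rewrite !natrM; field.
by rewrite A0 k0 /= addrC natr1 pnatr_eq0.
Qed.

(** The bound [M] of the box of summation is kept apart from the number [m] of
    trials, so that inductions on [m] take place over one index type; for
    [m <= M] the box contains the support. *)
Definition pmf_mean {R : realType} {K : nat} (M m : nat) (p : 'cV[R]_K)
    (F : ('I_K -> nat) -> R) : R :=
  \sum_(k : {ffun 'I_K -> 'I_M.+1})
    multinomial_pmf m p (fun i => k i) * F (fun i => k i).

(** * Moments *)

Section moments.
Context {R : realType} {K M : nat}.
Implicit Types (p : 'cV[R]_K) (F : ('I_K -> nat) -> R).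

(** Only vectors with [k_i > 0] contribute on the left, and these are the
    [incr i k] with [k] in the support for [m] trials. *)
Lemma pmf_mean_sizebias m p (i : 'I_K) F : (m < M)%N ->
  pmf_mean M m.+1 p (fun k => (k i)%:R * F k) =
  m.+1%:R * p i 0 * pmf_mean M m p (fun k => F (incr i k)).
Proof.
move=> mM; rewrite /pmf_mean mulr_sumr.
rewrite (bigID (fun k : {ffun 'I_K -> 'I_M.+1} =>
  (\sum_j k j == m.+1)%N && (0 < k i)%N)) /= [X in _ + X]big1 ?addr0; last first.
  move=> k; rewrite negb_and -leqNgt leqn0 /multinomial_pmf.
  by case: eqP => [_ /= /eqP ->|_ _]; rewrite ?mul0r ?mulr0.
rewrite [RHS](bigID (fun k : {ffun 'I_K -> 'I_M.+1} => (\sum_j k j == m)%N)) /=.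
rewrite [X in _ = _ + X]big1 ?addr0; last first.
  by move=> k /negPf km; rewrite /multinomial_pmf km mul0r mulr0.
(* [incr i] and its inverse, inside the box: [inord] never truncates on the
   supports, as [m.+1 <= M] bounds every coordinate. *)
pose h (k : {ffun 'I_K -> 'I_M.+1}) : {ffun 'I_K -> 'I_M.+1} :=
  [ffun j => inord (incr i (fun l => k l) j)].
pose h' (k : {ffun 'I_K -> 'I_M.+1}) : {ffun 'I_K -> 'I_M.+1} :=
  [ffun j => inord (k j - (j == i))].
have le_sum (k : 'I_K -> nat) j : (k j <= \sum_l k l)%N.
  by rewrite (bigD1 j) //= leq_addr.
have hE (k : {ffun 'I_K -> 'I_M.+1}) : (\sum_j k j == m)%N ->
    (fun j => h k j : nat) = incr i (fun l => k l).
  move=> /eqP km; apply/funext => j; rewrite ffunE inordK // ltnS.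
  by rewrite (leq_trans (le_sum _ j)) // sum_incr km.
have h'E (k : {ffun 'I_K -> 'I_M.+1}) j : h' k j = (k j - (j == i))%N :> nat.
  by rewrite ffunE inordK // (leq_ltn_trans (leq_subr _ _)).
have h'K (k : {ffun 'I_K -> 'I_M.+1}) : (0 < k i)%N ->
    incr i (fun l => h' k l) = (fun l => k l : nat).
  move=> ki; apply/funext => j; rewrite /incr h'E subnK //.
  by case: eqP => // ->.
rewrite (reindex_onto h h') /=; last first.
  move=> k /andP[_ ki]; apply/ffunP => j; apply/val_inj.
  by rewrite ffunE (h'K k ki) inord_val.
have hP (k : {ffun 'I_K -> 'I_M.+1}) : (\sum_j k j == m)%N =
    ((\sum_j h k j == m.+1)%N && (0 < h k i)%N && (h' (h k) == k)).
  apply/idP/idP => [km|/andP[/andP[hm hi] /eqP hk]].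
    have hj j : h k j = incr i (fun l => k l) j :> nat.
      by rewrite -(hE k km).
    have -> : (\sum_j h k j = m.+1)%N.
      by under eq_bigr do rewrite hj; rewrite sum_incr (eqP km).
    rewrite eqxx hj /incr eqxx addn1 /=; apply/eqP/ffunP => j; apply/val_inj.
    by rewrite /= h'E hj /incr addnK.
  by rewrite -eqSS -(eqP hm) -(sum_incr i) -{1}hk (h'K _ hi).
under [RHS]eq_bigl do rewrite hP.
apply: eq_bigr => k; rewrite -hP => km.
rewrite (_ : h k i = (k i).+1 :> nat); last first.
  have -> : h k i = incr i (fun l => k l) i :> nat by rewrite -(hE k km).
  by rewrite /incr eqxx addn1.
by rewrite hE // !mulrA multinomial_pmf_incr.
Qed.

Lemma pmf_meanD m p F F' :
  pmf_mean M m p (fun k => F k + F' k) = pmf_mean M m p F + pmf_mean M m p F'.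
Proof. by rewrite -big_split; apply: eq_bigr => k _; rewrite mulrDr. Qed.

Lemma pmf_meanZ m p c F : pmf_mean M m p (fun k => c * F k) = c * pmf_mean M m p F.
Proof. by rewrite mulr_sumr; apply: eq_bigr => k _; rewrite mulrCA. Qed.

Lemma pmf_mean_sum (I : finType) m p (F : I -> ('I_K -> nat) -> R) :
  pmf_mean M m p (fun k => \sum_i F i k) = \sum_i pmf_mean M m p (F i).
Proof. by rewrite exchange_big; apply: eq_bigr => k _; rewrite mulr_sumr. Qed.

Lemma pmf_mean1 m p : (m <= M)%N -> \sum_i p i 0 = 1 -> pmf_mean M m p (fun=> 1) = 1.
Proof.
move=> + p1; elim: m => [_|m IH mM].
  rewrite /pmf_mean (bigD1 [ffun=> ord0]) //= big1 => [|k k0].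
    rewrite /multinomial_pmf big1 ?eqxx => [|i _]; last by rewrite ffunE.
    rewrite !big1 => [|i _|i _]; rewrite ?ffunE //=.
    by rewrite divr1 !mulr1 addr0.
  rewrite /multinomial_pmf sum_nat_eq0; case: ifP => [/forallP k00|_].
    by case/eqP: k0; apply/ffunP => i; apply/val_inj; rewrite ffunE /=; apply/eqP/k00.
  by rewrite mul0r.
have m0 : m.+1%:R != 0 :> R by rewrite pnatr_eq0.
(* On the support [m.+1] is the sum of the coordinates, each of which can be
   size biased. *)
apply: (mulfI m0); rewrite -pmf_meanZ mulr1.
transitivity (pmf_mean M m.+1 p (fun k => \sum_i (k i)%:R * 1)).
  apply: eq_bigr => k _; rewrite /multinomial_pmf.
  case: eqP => [km|_]; last by rewrite !mul0r.
  by congr (_ * _); rewrite -km natr_sum; apply: eq_bigr => i _; rewrite mulr1.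
rewrite pmf_mean_sum; under eq_bigr do rewrite pmf_mean_sizebias //.
by rewrite -mulr_suml -mulr_sumr p1 IH 1?ltnW // !mulr1.
Qed.

Lemma pmf_mean_coord m p i : (m <= M)%N -> \sum_i p i 0 = 1 ->
  pmf_mean M m p (fun k => (k i)%:R) = m%:R * p i 0.
Proof.
case: m => [_ _|m mM p1].
  rewrite mul0r; apply: big1 => k _; rewrite /multinomial_pmf.
  rewrite sum_nat_eq0; case: ifP => [/forallP/(_ i)/eqP ->|_]; last by rewrite mul0r.
  by rewrite mulr0.
transitivity (pmf_mean M m.+1 p (fun k => (k i)%:R * 1)).
  by apply: eq_bigr => k _; rewrite mulr1.
by rewrite pmf_mean_sizebias // pmf_mean1 // 1?ltnW // mulr1.
Qed.

Lemma pmf_mean_coordM m p i j : (m <= M)%N -> \sum_i p i 0 = 1 ->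
  pmf_mean M m p (fun k => (k i)%:R * (k j)%:R) =
  m%:R * (m%:R - 1) * p i 0 * p j 0 + m%:R * p i 0 * (i == j)%:R.
Proof.
case: m => [_ _|m mM p1].
  rewrite !mul0r addr0; apply: big1 => k _; rewrite /multinomial_pmf.
  rewrite sum_nat_eq0; case: ifP => [/forallP/(_ i)/eqP ->|_]; last by rewrite mul0r.
  by rewrite mul0r mulr0.
rewrite (pmf_mean_sizebias m p i (fun k => (k j)%:R)) //.
transitivity (m.+1%:R * p i 0 *
    pmf_mean M m p (fun k => (k j)%:R + (j == i)%:R * 1)).
  by congr (_ * _); apply: eq_bigr => k _; rewrite /incr natrD mulr1.
rewrite pmf_meanD pmf_meanZ pmf_mean1 ?pmf_mean_coord // 1?ltnW //.
rewrite -natr1 [j == i]eq_sym; ring.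
Qed.

Lemma pmf_mean_cov m p (a b : 'I_K -> R) : (m <= M)%N -> \sum_i p i 0 = 1 ->
  pmf_mean M m p (fun k => (\sum_i a i * ((k i)%:R - m%:R * p i 0)) *
                        (\sum_j b j * ((k j)%:R - m%:R * p j 0))) =
  m%:R * (\sum_i a i * b i * p i 0 - (\sum_i a i * p i 0) * (\sum_j b j * p j 0)).
Proof.
move=> mM p1.
transitivity (pmf_mean M m p (fun k => \sum_i \sum_j (a i * b j) *
    ((k i)%:R * (k j)%:R + (- (m%:R * p j 0) * (k i)%:R +
     (- (m%:R * p i 0) * (k j)%:R + (m%:R * p i 0 * (m%:R * p j 0)) * 1))))).
  apply: eq_bigr => k _; congr (_ * _); rewrite mulr_suml; apply: eq_bigr => i _.
  by rewrite mulr_sumr; apply: eq_bigr => j _; ring.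
rewrite pmf_mean_sum mulr_suml -sumrB mulr_sumr; apply: eq_bigr => i _.
rewrite pmf_mean_sum.
under eq_bigr => j _.
  rewrite pmf_meanZ !pmf_meanD !pmf_meanZ pmf_mean_coordM //.
  rewrite !pmf_mean_coord // pmf_mean1 //.
  over.
transitivity (\sum_j ((if j == i then m%:R * (a i * b i * p i 0) else 0) -
    m%:R * (a i * p i 0) * (b j * p j 0))).
  by apply: eq_bigr => j _; rewrite [i == j]eq_sym; case: eqP => [->|_] /=; ring.
rewrite sumrB -big_mkcond big_pred1_eq -mulr_sumr; ring.
Qed.

End moments.

(** * Expectations of functions of a multinomial vector *)

Section expectation.
Context {R : realType} {K : nat} {d : measure_display} {T : measurableType d}.
Context {P : probability T R} (m : nat) (p : 'cV[R]_K).
Variable W : 'I_K -> {RV P >-> nat}.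
Hypothesis Wp : multinomial m p W.
Hypothesis p1 : \sum_i p i 0 = 1.

Let E (k : {ffun 'I_K -> 'I_m.+1}) : set T := [set t | forall i, W i t = k i].

Let mE k : measurable (E k).
Proof.
rewrite (_ : E k = \bigcap_(i in setT) (W i @^-1` [set nat_of_ord (k i)])).
  apply: fin_bigcap_measurable => // i _; rewrite -[_ @^-1` _]setTI.
  exact: measurable_funP.
by apply/seteqP; split => t /= H i; [move=> _|]; exact: H.
Qed.

Let B := \big[setU/set0]_(k <- index_enum {ffun 'I_K -> 'I_m.+1}) E k.

Let integral_B (F : ('I_K -> nat) -> R) :
  measurable_fun setT (fun t => F (fun i => W i t)) ->
  (\int[P]_(t in B) (F (fun i => W i t))%:E = (pmf_mean m m p F)%:E)%E.
Proof.
move=> mF; rewrite integral_bigsetU_EFin ?index_enum_uniq //; first last.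
- by apply/measurable_EFinP; apply: measurable_funS mF.
- apply/trivIsetP => k l _ _ kl; apply/seteqP; split => // t [/= tk tl].
  by case/eqP: kl; apply/ffunP => i; apply/val_inj; rewrite /= -tk -tl.
rewrite -sumEFin; apply: eq_bigr => k _.
transitivity (\int[P]_(t in E k) (cst (F (fun i => k i))%:E t))%E.
  by apply: eq_integral => t /set_mem tk; congr (F _)%:E; apply/funext.
by rewrite integral_cst // muleC EFinM; congr (_ * _)%E; exact: Wp.
Qed.

(** The level sets of [W] over the box have union [B], and [F = 1] in
    [integral_B] gives [B] probability 1; off [B] the integral vanishes. *)
Lemma multinomial_expectation (F : ('I_K -> nat) -> R) :
  measurable_fun setT (fun t => F (fun i => W i t)) ->
  ('E_P[fun t => F (fun i => W i t)] = (pmf_mean m m p F)%:E)%E.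
Proof.
move=> mF.
have mB : measurable B by apply: bigsetU_measurable => k _; exact: mE.
have PB : P B = 1%E.
  rewrite -[LHS]mul1e -integral_cst //.
  by rewrite (integral_B (fun=> 1)) // pmf_mean1.
have PB0 : P (~` B) = 0%E by rewrite probability_setC // PB subee.
rewrite unlock -[setT](setUv B) integral_setU //; first last.
- by apply/disj_setPS; rewrite setICr.
- by rewrite setUv; exact/measurable_EFinP.
- exact: measurableC.
rewrite [X in (_ + X)%E]null_set_integral ?adde0 ?integral_B //.
  exact: measurableC.
by apply/measurable_EFinP; apply: measurable_funS mF.
Qed.

(** Stated for affine functions, which is the form of the linearised estimator;
    the joint moments then need no integrability argument. *)
Lemma multinomial_covariance (u v : R) (a b : 'I_K -> R) :
  covariance P (fun t => u + \sum_i a i * ((W i t)%:R - m%:R * p i 0))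
               (fun t => v + \sum_i b i * ((W i t)%:R - m%:R * p i 0)) =
  (m%:R * (\sum_i a i * b i * p i 0 -
    (\sum_i a i * p i 0) * (\sum_i b i * p i 0)))%:E.
Proof.
pose L (c : 'I_K -> R) (k : 'I_K -> nat) := \sum_i c i * ((k i)%:R - m%:R * p i 0).
have mL c : measurable_fun setT (fun t => L c (fun i => W i t)).
  apply: measurable_sum => i; apply: measurable_funM => //.
  apply: measurable_funB => //.
  by apply: measurableT_comp => //.
have EL (u' : R) c : ('E_P[fun t => (u' + L c (fun i => W i t))%R] = u'%:E)%E.
  rewrite (multinomial_expectation (fun k => u' + L c k)); last first.
    exact: measurable_funD.
  congr _%:E.
  transitivity (pmf_mean m m p (fun k => u' * 1 + L c k)).
    by apply: eq_bigr => k _; rewrite mulr1.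
  rewrite pmf_meanD pmf_meanZ pmf_mean1 // mulr1 /L pmf_mean_sum big1 ?addr0 // => i _.
  rewrite pmf_meanZ.
  transitivity (c i * pmf_mean m m p (fun k => (k i)%:R + - (m%:R * p i 0) * 1)).
    by congr (_ * _); apply: eq_bigr => k _; rewrite mulr1.
  by rewrite pmf_meanD pmf_meanZ pmf_mean1 // pmf_mean_coord // mulr1 subrr mulr0.
rewrite covariance.unlock (EL u a) (EL v b).
rewrite -(@pmf_mean_cov _ _ m m p a b) //.
rewrite -(multinomial_expectation (fun k => L a k * L b k)); last first.
  exact: measurable_funM.
congr ('E_P[_]%E); apply/funext => t /=; rewrite !fctE /=.
by rewrite ![_ + L _ _ - _]addrAC !subrr !add0r.
Qed.

End expectation.

(** * Sample covariances *)

Section sample_covariance.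
Context {R : realType} {N D : nat}.
Implicit Type x : 'I_N -> 'cV[R]_D.

Lemma sample_cov_mulmx D' (A : 'M[R]_(D', D)) x :
  sample_cov (fun n => A *m x n) = A *m sample_cov x *m A^T.
Proof.
rewrite /sample_cov -scalemxAr -scalemxAl; congr (_ *: _).
rewrite mulmx_sumr mulmx_suml; apply: eq_bigr => n _.
by rewrite -mulmxA -mulmxA -trmx_mul mulmxA mulmxBr -scalemxAr mulmx_sumr.
Qed.

Lemma sample_covE x i j : (0 < N)%N ->
  sample_cov x i j = N%:R^-1 * \sum_n x n i 0 * x n j 0 -
    (N%:R^-1 * \sum_n x n i 0) * (N%:R^-1 * \sum_n x n j 0).
Proof.
move=> N0; have NU : N%:R != 0 :> R by rewrite pnatr_eq0 -lt0n.
rewrite /sample_cov; set xb : 'cV[R]_D := N%:R^-1 *: \sum_n x n.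
have xbE l : N%:R^-1 * (\sum_n x n l 0) = xb l 0 by rewrite mxE summxE.
clearbody xb; rewrite !mxE summxE.
under eq_bigr do rewrite !mxE big_ord1 !mxE.
transitivity (N%:R^-1 * \sum_n (x n i 0 * x n j 0 - x n i 0 * xb j 0 -
    xb i 0 * x n j 0 + xb i 0 * xb j 0)).
  by congr (_ * _); apply: eq_bigr => n _; ring.
rewrite big_split !sumrB /= -mulr_suml -mulr_sumr sumr_const card_ord.
by rewrite -mulr_natl -!xbE; field.
Qed.

End sample_covariance.

(** * Covariance of the linearised estimator *)

Theorem proposition4 (R : realType) (N D : nat)
    (g0 : 'cV[R]_D -> 'cV[R]_D) (g : 'I_N -> 'cV[R]_D -> 'cV[R]_D)
    (thetahat : 'cV[R]_D)
    (d : measure_display) (T : measurableType d) (P : probability T R)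
    (W : 'I_N -> {RV P >-> nat}) :
  (0 < N)%N ->
  contdiff g0 -> (forall n, contdiff (g n)) ->
  G g0 g thetahat (ones N) = 0 ->
  Hhat g0 g thetahat \in unitmx ->
  multinomial N (N%:R^-1 *: ones N) W ->
  covmx P (fun t => IJ1 g0 g thetahat (weights W t)) =
  map_mx EFin
    (N%:R^-1 *: (invmx (Hhat g0 g thetahat)
                 *m sample_cov (fun n => g n thetahat)
                 *m (invmx (Hhat g0 g thetahat))^T)).
Proof.
move=> N0 _ _ _ _ WN.
have NU : N%:R != 0 :> R by rewrite pnatr_eq0 -lt0n.
have pE i : (N%:R^-1 *: ones N) i 0 = N%:R^-1 :> R by rewrite !mxE mulr1.
have p1 : \sum_i (N%:R^-1 *: ones N) i 0 = 1 :> R.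
  under eq_bigr do rewrite pE.
  by rewrite sumr_const card_ord -[_ *+ _]mulr_natr mulVf.
rewrite -sample_cov_mulmx; set H := invmx _.
pose x n : 'cV[R]_D := H *m g n thetahat.
(* The centring [w_n - 1] is written [w_n - m p_n], as in
   [multinomial_covariance]. *)
have IJE t i : IJ1 g0 g thetahat (weights W t) i 0 = thetahat i 0 +
    \sum_n (- N%:R^-1 * x n i 0) *
           ((W n t)%:R - N%:R * (N%:R^-1 *: ones N) n 0).
  rewrite /IJ1 -/H -scalemxAr mulmx_sumr !mxE; congr (_ + _).
  rewrite summxE mulr_sumr -sumrN; apply: eq_bigr => n _.
  by rewrite pE mulfV // -scalemxAr !mxE; ring.
apply/matrixP => i j; rewrite [LHS]mxE [RHS]mxE.
under [X in covariance P X _]eq_fun do rewrite IJE.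
under [X in covariance P _ X]eq_fun do rewrite IJE.
rewrite (multinomial_covariance _ _ W WN p1) mxE -/x sample_covE //; congr _%:E.
clearbody x.
have sumap l : \sum_n - N%:R^-1 * x n l 0 * (N%:R^-1 *: ones N) n 0 =
    - N%:R^-1 * N%:R^-1 * \sum_n x n l 0.
  by rewrite mulr_sumr; apply: eq_bigr => n _; rewrite pE mulrAC.
have sumabp : \sum_n - N%:R^-1 * x n i 0 * (- N%:R^-1 * x n j 0) *
    (N%:R^-1 *: ones N) n 0 = N%:R^-1 ^+ 3 * \sum_n x n i 0 * x n j 0.
  by rewrite mulr_sumr; apply: eq_bigr => n _; rewrite pE; ring.
by rewrite !sumap sumabp; field.
Qed.
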